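(* Let $X_1,X_2$ be complex Banach spaces and let $\mathfrak{L}_1$ be a subspace lattice in $X_1$ and $\mathfrak{L}_2$ a subspace lattice in $X_2$. The ordinal sum $$\mathfrak{S}=\{M_1\oplus\{0\}: M_1\in\mathfrak{L}_1\}\cup\{X_1\oplus M_2: M_2\in\mathfrak{L}_2\},$$ a subspace lattice in $X_1\oplus X_2$, is reflexive if and only if both $\mathfrak{L}_1$ and $\mathfrak{L}_2$ are reflexive.
   Context: A subspace of a Banach space $X$ means a closed linear subspace; $\mathfrak{C}(X)$ is the family of all subspaces. Joins and meets: $\bigvee_j M_j$ is the closed linear span of the $M_j$, $\bigwedge_j M_j=\bigcap_j M_j$, with $\bigvee\emptyset=\{0\}$ and $\bigwedge\emptyset=X$. A subspace lattice in $X$ is a family $\mathfrak{L}\subseteq\mathfrak{C}(X)$ containing $\{0\}$ and $X$ and closed under arbitrary joins and meets. $\mathcal{B}(X)$ is the algebra of bounded linear operators on $X$; $\operatorname{Alg}(\mathfrak{F})=\{A\in\mathcal{B}(X): AM\subseteq M\text{ for all }M\in\mathfrak{F}\}$; $\operatorname{Lat}(\mathcal{T})=\{M\in\mathfrak{C}(X): TM\subseteq M\text{ for all }T\in\mathcal{T}\}$. A subspace lattice $\mathfrak{L}$ is reflexive if $\operatorname{Lat}\operatorname{Alg}(\mathfrak{L})=\mathfrak{L}$. $X_1\oplus X_2$ is the (Banach space) direct sum of $X_1$ and $X_2$. *)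

(* Defs.v *)
From HB Require Import structures.
From mathcomp Require Import all_boot all_order all_algebra complex.
From mathcomp Require Import all_classical all_reals all_analysis.

Set Implicit Arguments.
Unset Strict Implicit.
Unset Printing Implicit Defensive.

Import Order.TTheory GRing.Theory Num.Theory.
Import numFieldNormedType.Exports.

Local Open Scope classical_set_scope.
Local Open Scope ring_scope.

Section SubspaceLattices.
Context {K : numFieldType} {X : normedModType K}.
Implicit Types (F L : set (set X)).

Definition closed_subspace : set (set X) :=
  [set M : set X | submod_closed (mem M) /\ closed M].

Definition linear_span (A : set X) : set X :=
  [set x | exists (n : nat) (a : 'I_n -> K) (v : 'I_n -> X),
    (forall i, A (v i)) /\ x = \sum_(i < n) a i *: v i].

Definition subspace_join F : set X :=
  closure (linear_span (\bigcup_(M in F) M)).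

Definition subspace_meet F : set X := \bigcap_(M in F) M.

Definition subspace_lattice L : Prop :=
  [/\ L `<=` closed_subspace,
      L [set 0],
      L setT,
      (forall F, F `<=` L -> L (subspace_join F)) &
      (forall F, F `<=` L -> L (subspace_meet F))].

(* For a linear map, [bounded_near A (nbhs 0)] says that A is a bounded
   operator: see [linear_boundedP] and [linear_bounded_continuous]. *)
Definition Alg F : set {linear X -> X} :=
  [set A | bounded_near A (nbhs (0 : X)) /\ forall M, F M -> A @` M `<=` M].

Definition Lat (T : set {linear X -> X}) : set (set X) :=
  [set M | closed_subspace M /\ forall A, T A -> A @` M `<=` M].

Definition reflexive_lattice L : Prop := Lat (Alg L) = L.

End SubspaceLattices.

(* The direct sum is the product type, which carries the max norm; every other
   usual norm on the direct sum is equivalent to it, so that neither closed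
   subspaces nor bounded operators depend on this choice. *)
Definition ordinal_sum {K : numFieldType} {X1 X2 : normedModType K}
    (L1 : set (set X1)) (L2 : set (set X2)) : set (set (X1 * X2)) :=
  [set M1 `*` [set 0] | M1 in L1] `|` [set setT `*` M2 | M2 in L2].

(* The library has no completeness result for products: with the max norm, the
   direct sum of two Banach spaces is again a Banach space. *)
Lemma prod_complete {K : numFieldType} {X1 X2 : completeNormedModType K}
    (F : set_system (X1 * X2)) :
  ProperFilter F -> cauchy F -> exists p : X1 * X2, F --> p.
Proof.
move=> FF /cauchy_ballP Fc.
have F1 : cvg (fst @ F).
  apply: cauchy_cvg; apply/cauchy_ballP => e /Fc [[A B] /= [FA FB] AB].
  rewrite near_map2; exists (A, B) => //= -[x y] /AB.
  by case.
have F2 : cvg (snd @ F).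
  apply: cauchy_cvg; apply/cauchy_ballP => e /Fc [[A B] /= [FA FB] AB].
  rewrite near_map2; exists (A, B) => //= -[x y] /AB.
  by case.
exists (lim (fst @ F), lim (snd @ F)).
have FH := cvg_pair F1 F2.
move=> A /FH /=; rewrite !nbhs_simpl /=.
by apply: filterS => -[x y].
Qed.

(* Main.v *)
Require Import Defs.
From HB Require Import structures.
From mathcomp Require Import all_boot all_order all_algebra complex.
From mathcomp Require Import all_classical all_reals all_analysis.
From mathcomp Require Import ring lra.
Import Order.TTheory GRing.Theory Num.Theory.
Import numFieldNormedType.Exports.
Local Open Scope classical_set_scope.
Local Open Scope ring_scope.

(** An operator leaving every member of the ordinal sum invariant is a block
    matrix [A B; 0 D] with A in Alg L1, D in Alg L2 and B an arbitrary bounded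
    operator from X2 to X1.  Restricting to the diagonal blocks shows that
    reflexivity passes to both summands.  Conversely, an invariant subspace N
    not contained in X1 (+) 0 has an element (x, y) with y != 0; a Hahn-Banach
    functional f with f y = 1 and the operators (u, v) |-> (f v *: z, 0) force N
    to contain X1 (+) 0, so that N = X1 (+) M with M invariant under Alg L2. *)

(** * Hahn-Banach theorem for a sublinear functional on a real vector space *)

Section HahnBanach.
Context {R : realType} {V : lmodType R} (p : V -> R).
Hypothesis pD : forall x y, p (x + y) <= p x + p y.
Hypothesis pZ : forall t x, 0 <= t -> p (t *: x) = t * p x.

(** Partial linear functionals are encoded by their graphs, so that extension is inclusion and
    unions of chains can be formed. Single-valuedness follows from domination, by [graph_fun]. *)
Let dominated_graph (G : set (V * R)) : Prop :=
  (forall t x y a b, G (x, a) -> G (y, b) -> G (t *: x + y, t * a + b)) /\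
  (forall x a, G (x, a) -> a <= p x).

Let p0 : p 0 = 0.
Proof. by rewrite -(scale0r 0) pZ// mul0r. Qed.

Let oppr_le_p x : - p x <= p (- x).
Proof. by rewrite -subr_ge0 opprK addrC -p0 -(subrr x) pD. Qed.

(** Subtracting two pairs over [x] gives a pair over [0], whose value is at most [p 0 = 0];
    exchanging the pairs gives equality. *)
Let graph_fun G x a b : dominated_graph G -> G (x, a) -> G (x, b) -> a = b.
Proof.
suff le c d : dominated_graph G -> G (x, c) -> G (x, d) -> d <= c.
  by move=> dG Ga Gb; apply/eqP; rewrite eq_le !le.
move=> [lG pG] Gc Gd; have := pG _ _ (lG (-1) _ _ _ _ Gc Gd).
by rewrite scaleN1r addNr p0 mulN1r addrC subr_le0.
Qed.

(** A value [c] at [v] keeps domination when [a - p (x - v) <= c <= p (y + v) - b] for all pairs of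
    [G]. Each lower bound is below each upper one, since [a + b <= p (x + y) <= p (x - v) + p (y +
    v)]; take for [c] the supremum of the lower bounds. *)
Let graph_extend G v x0 a0 : dominated_graph G -> G (x0, a0) ->
  exists G' c, [/\ dominated_graph G', G `<=` G' & G' (v, c)].
Proof.
move=> [lG pG] G0.
have G00 : G (0, 0).
  by have := lG (-1) _ _ _ _ G0 G0; rewrite scaleN1r mulN1r !addNr.
have GZ t x a : G (x, a) -> G (t *: x, t * a).
  by move=> Gx; have := lG t _ _ _ _ Gx G00; rewrite !addr0.
pose E := [set s | exists x a, G (x, a) /\ s = a - p (x - v)].
have Eub y b : G (y, b) -> ubound E (p (y + v) - b).
  move=> Gy _ [x [a [Gx ->]]]; rewrite lerBrDr addrAC lerBlDr.
  have /pG := lG 1 _ _ _ _ Gx Gy; rewrite scale1r mul1r => /le_trans; apply.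
  by rewrite (le_trans _ (pD _ _))// addrACA addrA addrK addrC.
have supE : has_sup E.
  split; first by exists (0 - p (0 - v)), 0, 0.
  by exists (p (0 + v) - 0); exact: Eub.
pose c := sup E.
have c_lo x a : G (x, a) -> a - p (x - v) <= c.
  by move=> Gx; apply: ub_le_sup; [case: supE | exists x, a].
have c_hi y b : G (y, b) -> c <= p (y + v) - b.
  by move=> Gy; apply: ge_sup; [case: supE | exact: Eub].
exists [set z | exists x a t, G (x, a) /\ z = (x + t *: v, a + t * c)], c.
split; first split.
- move=> t _ _ _ _ [x [a [r [Gx [-> ->]]]]] [y [b [s [Gy [-> ->]]]]].
  exists (t *: x + y), (t * a + b), (t * r + s); split; first exact: lG.
  congr (_, _); last by ring.
  by rewrite scalerDr scalerDl scalerA addrACA.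
- move=> _ _ [x [a [t [Gx [-> ->]]]]].
  (* By homogeneity, negative [t] reduces to the lower bound on [c] and positive [t] to the upper
     bound. *)
  have [t0|t0|->] := ltgtP t 0; last by rewrite scale0r mul0r !addr0 pG.
  + have t0' : - t > 0 by rewrite oppr_gt0.
    have := c_lo _ _ (GZ (- t)^-1 _ _ Gx).
    rewrite -(ler_pM2l t0') mulrBr -(pZ _ _ (ltW t0')) scalerBr scalerA.
    rewrite [- t * (_ * a)]mulrA divff ?gt_eqF// scale1r mul1r scaleNr opprK mulNr.
    lra.
  + have := c_hi _ _ (GZ t^-1 _ _ Gx).
    rewrite -(ler_pM2l t0) mulrBr -(pZ _ _ (ltW t0)) scalerDr scalerA.
    rewrite [t * (_ * a)]mulrA divff ?gt_eqF// scale1r mul1r.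
    lra.
- by move=> [x a] Gx; exists x, a, 0; rewrite scale0r mul0r !addr0.
- by exists 0, 0, 1; rewrite scale1r mul1r !add0r.
Qed.

(** A maximal dominated graph through [(v0, p v0)] is total by [graph_extend], hence the graph of a
    linear map. *)
Lemma hahn_banach (v0 : V) :
  exists f : {linear V -> R^o}, f v0 = p v0 /\ forall x, f x <= p x.
Proof.
(* The union of the empty chain is empty, so the Zorn property must hold of
   [set0]: that the graph passes through [(v0, p v0)] is required only of
   nonempty graphs. *)
have [A [[dA A0] Amax]] : exists A, (dominated_graph A /\
      (A !=set0 -> A (v0, p v0))) /\ forall B, A `<` B ->
      ~ (dominated_graph B /\ (B !=set0 -> B (v0, p v0))).
  apply: Zorn_bigcup => F FP Ftot; split; last first.
    by move=> [z [X FX Xz]]; exists X => //; apply: (FP _ FX).2; exists z.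
  split; last by move=> x a [X FX /(FP _ FX).1.2].
  move=> t x y a b [X FX Xx] [Y FY Yy].
  have [XY|YX] := Ftot _ _ FX FY.
    by exists Y => //; apply: (FP _ FY).1.1 => //; exact: XY.
  by exists X => //; apply: (FP _ FX).1.1 => //; exact: YX.
have Av0 : A (v0, p v0).
  apply: A0; apply: contrapT => /nonemptyPn A0.
  (* The line through [(v0, p v0)] would properly extend the empty graph. It is dominated, for
     negative [t] because [- p x <= p (- x)]. *)
  apply: (Amax [set z | exists t, z = (t *: v0, t * p v0)]).
    rewrite A0 properEneq; split; last by [].
    apply/eqP => /seteqP[_ /(_ (v0, p v0))]; apply.
    by exists 1; rewrite scale1r mul1r.
  split; last by exists 1; rewrite scale1r mul1r.
  split.
    move=> t _ _ _ _ [r [-> ->]] [s [-> ->]]; exists (t * r + s).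
    by rewrite scalerDl mulrDl scalerA mulrA.
  move=> _ _ [t [-> ->]]; have [t0|/ltW t0] := leP 0 t; first by rewrite pZ.
  rewrite -[t]opprK scaleNr mulNr -pZ ?oppr_ge0//; exact: oppr_le_p.
have tot x : exists a, A (x, a).
  have [G' [c [dG' AG' G'x]]] := graph_extend _ x _ _ dA Av0.
  exists c; apply: contrapT => nAx; apply: (Amax G'); last by split=> // _; exact: AG'.
  by split=> // /(_ _ G'x).
have [f fA] := choice tot.
have f_lin : linear (f : V -> R^o).
  by move=> t x y; apply: (graph_fun _ _ _ _ dA (fA _)); exact: dA.1.
pose fL := GRing.isLinear.Build R V R^o _ f f_lin.
pose F : {linear V -> R^o} := HB.pack (f : V -> R^o) fL.
exists F; split=> [|x]; first exact: (graph_fun _ _ _ _ dA (fA _)).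
exact: (dA.2 _ _ (fA x)).
Qed.

End HahnBanach.

(** * Continuous functionals on complex normed spaces, by restriction to real scalars *)

Section Realification.
Context {R : realType}.

(** An alias, so that the real scalar action is an instance kept apart from the complex one on
    [X]. *)
Definition realified (X : lmodType R[i]) : Type := X.

Section Lmodule.
Context {X : lmodType R[i]}.

HB.instance Definition _ := GRing.Zmodule.on (realified X).

Let rscale (t : R) (x : realified X) : realified X := t%:C%C *: (x : X).

Let rscaleA a b v : rscale a (rscale b v) = rscale (a * b) v.
Proof. by rewrite /rscale scalerA rmorphM. Qed.

Let rscale1 : left_id 1 rscale.
Proof. by move=> v; rewrite /rscale scale1r. Qed.

Let rscaleDr : right_distributive rscale +%R.
Proof. by move=> a u v; rewrite /rscale scalerDr. Qed.

Let rscaleDl v : {morph rscale^~ v : a b / a + b}.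
Proof. by move=> a b; rewrite /rscale rmorphD scalerDl. Qed.

HB.instance Definition _ := GRing.Zmodule_isLmodule.Build R (realified X)
  rscaleA rscale1 rscaleDr rscaleDl.

Lemma realifiedZ (t : R) (x : X) : t *: (x : realified X) = t%:C%C *: x.
Proof. by []. Qed.

End Lmodule.
End Realification.

(** Hahn-Banach for the norm gives a real functional [f] with [f y] the norm of [y]; it is made
    complex linear and divided by its value at [y]. *)
Lemma continuous_functional_eq1 {R : realType} {X : normedModType R[i]} (y : X) :
  y != 0 -> exists f : {linear X -> R[i]^o}, continuous f /\ f y = 1.
Proof.
move=> y0.
pose q (x : realified X) : R := complex.Re `|x : X|.
have qE x : (q x)%:C%C = `|x : X|.
  by rewrite /q; apply/RRe_real; exact: normr_real.
have qD x z : q (x + z) <= q x + q z.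
  by rewrite -lecR rmorphD /= !qE ler_normD.
have qZ t x : 0 <= t -> q (t *: x) = t * q x.
  move=> t0; apply/complexI; rewrite rmorphM /= !qE realifiedZ normrZ ger0_norm//.
  by rewrite lecR.
have [f [fy fq]] := hahn_banach q qD qZ y.
have f_le x : `|f x| <= q x.
  rewrite ler_norml fq andbT lerNl -linearN (le_trans (fq _))//.
  by rewrite -lecR !qE normrN.
(* The complex-linear functional whose real part is [f]. *)
pose g (x : X) : R[i] := (f x)%:C%C - 'i%C * (f ('i%C *: x))%:C%C.
have g_lin : linear (g : X -> R[i]^o).
  move=> a x z; rewrite /g.
  have fD (u v : X) : f (u + v : X) = f u + f v by exact: linearD.
  have fZ (t : R) (u : X) : f (t%:C%C *: u) = t * f u by exact: linearZ.
  have fC (b c : R) (u : X) : f ((b +i* c)%C *: u) = b * f u + c * f ('i%C *: u).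
    rewrite -!fZ -fD scalerA -scalerDl; congr (f (_ *: u)).
    by apply/eqP; rewrite eq_complex /= !(mul0r, mulr0, mulr1, subr0, add0r, addr0) !eqxx.
  case: a => a b; rewrite scalerDr !fD scalerA (fC a b).
  have -> : 'i%C * (a +i* b)%C = (- b +i* a)%C.
    by apply/eqP; rewrite eq_complex /= !(mul0r, mulr0, mul1r, sub0r, add0r, addr0) !eqxx.
  rewrite (fC (- b) a); apply/eqP; rewrite eq_complex /=; apply/andP; split; apply/eqP; ring.
have f_leC x : `|(f x)%:C%C| <= `|x : X| :> R[i].
  by rewrite normc_def /= expr0n addr0 sqrtr_sqr -qE lecR.
have normi : `|'i%C| = 1 :> R[i].
  by rewrite normc_def /= expr0n add0r expr1n sqrtr1.
have normiM (c : R[i]) : `|'i%C * c| = `|c| :> R[i].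
  by rewrite normrM normi mul1r.
have g_le x : `|g x| <= 2 * `|x|.
  rewrite (le_trans (ler_normB _ _))// mulr_natl mulr2n lerD ?f_leC//.
  by rewrite normiM (le_trans (f_leC _))// normrZ normi mul1r.
(* The real part of [g y] is [f y = q y], which vanishes only for [y = 0]. *)
have gy : g y != 0.
  apply/eqP => /(congr1 (@complex.Re R)); rewrite /g /=.
  rewrite !(mul0r, mulr0, subr0) fy => q0.
  by move/eqP: y0; apply; apply/normr0_eq0; rewrite -qE q0.
pose h (x : X) : R[i]^o := (g y)^-1 * g x.
have h_lin : linear h by move=> a x z; rewrite /h g_lin mulrDr scalerAr.
pose hL := GRing.isLinear.Build R[i] X R[i]^o _ h h_lin.
pose F : {linear X -> R[i]^o} := HB.pack h hL.
exists F; split; last by rewrite /F /= /h mulVf.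
apply/linear_bounded_continuous/linear_boundedP.
have bound_real : `|(g y)^-1| * 2 \is Num.real by rewrite ger0_real// mulr_ge0.
have [r0 [r0_real rge]] := nbhs_pinfty_ge bound_real.
exists r0; split=> // r /rge r_ge x; rewrite /F /= /h normrM.
by rewrite (le_trans (ler_wpM2l _ (g_le _)))// mulrA ler_wpM2r.
Qed.

Lemma continuousT_comp {T U V : topologicalType} (f : T -> U) (g : U -> V) :
  continuous f -> continuous g -> continuous (g \o f).
Proof. by move=> cf cg x; apply: continuous_comp; [exact: cf | exact: cg]. Qed.

(** * Closed subspaces, joins and reflexivity *)

Section ClosedSubspace.
Context {K : numFieldType}.
Implicit Types X Y : normedModType K.

Lemma closed_subspaceP {X} (M : set X) : closed_subspace M <->
  [/\ M 0, forall a u v, M u -> M v -> M (a *: u + v) & closed M].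
Proof.
split=> [[[M0 ML] cM]|[M0 ML cM]].
  split=> // [|a u v Mu Mv]; first exact: set_mem M0.
  by apply: set_mem; apply: ML; exact: mem_set.
split=> //; split; first exact: mem_set.
by move=> a u v /set_mem Mu /set_mem Mv; apply: mem_set; exact: ML.
Qed.

Lemma closed_subspace_mem0 {X} {M : set X} : closed_subspace M -> M 0.
Proof. by move=> /closed_subspaceP[]. Qed.

Lemma closed_subspace_preimage {X Y} (f : X -> Y) (M : set Y) :
  linear f -> continuous f -> closed_subspace M -> closed_subspace (f @^-1` M).
Proof.
move=> lf cf /closed_subspaceP[M0 ML cM]; apply/closed_subspaceP; split.
- by have := lf (-1) 0 0; rewrite scaler0 addr0 scaleN1r addNr /preimage /= => ->.
- by move=> a u v Mu Mv; rewrite /preimage /= lf; exact: ML.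
- by apply: preimage_closed => // x _; exact: cf.
Qed.

Lemma closed_subspaceX {X Y} (M : set X) (N : set Y) :
  closed_subspace M -> closed_subspace N -> closed_subspace (M `*` N).
Proof.
move=> /closed_subspaceP[M0 ML cM] /closed_subspaceP[N0 NL cN].
apply/closed_subspaceP; split=> //.
  by move=> a u v [Mu Nu] [Mv Nv]; split; [exact: ML | exact: NL].
rewrite (_ : M `*` N = fst @^-1` M `&` snd @^-1` N)//.
apply: closedI; apply: preimage_closed => // x _.
  exact: cvg_fst.
exact: cvg_snd.
Qed.

Lemma sub_linear_span {X} (A : set X) : A `<=` linear_span A.
Proof.
by move=> x Ax; exists 1%N, (fun=> 1), (fun=> x); rewrite big_ord1 scale1r.
Qed.

Lemma linear_span_closed {X} (A : set X) a u v :
  linear_span A u -> linear_span A v -> linear_span A (a *: u + v).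
Proof.
move=> [m [b [x [Ax ->]]]] [n [c [y [Ay ->]]]].
exists (m + n)%N, (fun i => match fintype.split i with inl j => a * b j | inr j => c j end),
  (fun i => match fintype.split i with inl j => x j | inr j => y j end).
split=> [i|]; first by case: (fintype.split i).
rewrite big_split_ord /= scaler_sumr; congr (_ + _); apply: eq_bigr => i _.
  by rewrite (unsplitK (inl i)) scalerA.
by rewrite (unsplitK (inr i)).
Qed.

(** Joint continuity of [(u, v) |-> a *: u + v] carries linearity from the span to its closure. *)
Lemma closed_subspace_join {X} (F : set (set X)) :
  closed_subspace (subspace_join F).
Proof.
apply/closed_subspaceP; split; last exact: closed_closure.
- apply: subset_closure; exists 0%N, (fun=> 0), (fun=> 0).
  by rewrite big_ord0; split=> // -[].
- move=> a u v cu cv B Bauv.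
  have : \forall z \near (u, v), B (a *: z.1 + z.2).
    have h : a *: z.1 + z.2 @[z --> (u, v)] --> a *: u + v.
      apply: cvgD; last exact: cvg_snd.
      by apply: cvgZl_tmp; exact: cvg_fst.
    exact: h Bauv.
  move=> [[U W] /= [/cu [u' [Su' Uu']] /cv [v' [Sv' Wv']]] UWB].
  exists (a *: u' + v'); split; first exact: linear_span_closed.
  exact: (UWB (u', v')).
Qed.

Lemma sub_subspace_join {X} (F : set (set X)) (N : set X) :
  F N -> N `<=` subspace_join F.
Proof.
move=> FN x Nx; apply: subset_closure; apply: sub_linear_span.
by exists N.
Qed.

Lemma subspace_join_min {X} (F : set (set X)) (M : set X) : closed_subspace M ->
  (forall N, F N -> N `<=` M) -> subspace_join F `<=` M.
Proof.
move=> /closed_subspaceP[M0 ML cM] FM.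
rewrite [X in _ `<=` X]((closure_id M).1 cM); apply: closureS.
move=> _ [n [a [v [Fv ->]]]]; elim/big_ind: _ => //.
  by move=> x y Mx My; rewrite -(scale1r x); exact: ML.
move=> i _; rewrite -[_ *: _]addr0; apply: ML => //.
by have [N FN Nv] := Fv i; exact: (FM _ FN).
Qed.

(** Trades bundled linear maps bounded near 0 for plain functions with proofs of linearity and
    continuity, so that explicit operators can be supplied directly. *)
Lemma Lat_AlgP {X} (L : set (set X)) (M : set X) : Lat (Alg L) M <->
  closed_subspace M /\ forall f : X -> X, linear f -> continuous f ->
    (forall N, L N -> forall x, N x -> N (f x)) -> forall x, M x -> M (f x).
Proof.
split=> -[cM HM]; split=> //.
  move=> f lf cf Lf x Mx.
  pose fL := GRing.isLinear.Build K X X _ f lf.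
  pose F : {linear X -> X} := HB.pack f fL.
  apply: (HM F); last by exists x.
  split; first exact/linear_bounded_continuous.
  by move=> N LN _ [z Nz <-]; exact: (Lf _ LN).
move=> A [bA LA] _ [x Mx <-]; apply: HM => //.
- exact: linearP.
- exact/linear_bounded_continuous.
- by move=> N LN z Nz; apply: (LA _ LN); exists z.
Qed.

Lemma reflexive_latticeP {X} (L : set (set X)) : L `<=` closed_subspace ->
  reflexive_lattice L <-> Lat (Alg L) `<=` L.
Proof.
move=> Lc; split=> [->//|LL]; apply/seteqP; split=> // M LM.
by split=> [|A [_ LA]]; [exact: Lc | exact: LA].
Qed.

End ClosedSubspace.

(** The common point [y] excludes empty second factors, which would erase the first ones. *)
Lemma setX_injl {T U} {M N : set T} {P Q : set U} (y : U) :
  M `*` P = N `*` Q -> P y -> Q y -> M = N.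
Proof.
move=> /seteqP[PQ QP] Py Qy; apply/seteqP; split=> x Hx.
  by have [] := PQ (x, y) (conj Hx Py).
by have [] := QP (x, y) (conj Hx Qy).
Qed.

Lemma setX_injr {T U} {M N : set T} {P Q : set U} (x : T) :
  M `*` P = N `*` Q -> M x -> N x -> P = Q.
Proof.
move=> /seteqP[PQ QP] Mx Nx; apply/seteqP; split=> y Hy.
  by have [] := PQ (x, y) (conj Mx Hy).
by have [] := QP (x, y) (conj Nx Hy).
Qed.

(** * The ordinal sum: lattice property and reflexivity *)

Section OrdinalSum.
Context {K : numFieldType} {X1 X2 : normedModType K}.
Variables (L1 : set (set X1)) (L2 : set (set X2)).
Hypotheses (hL1 : subspace_lattice L1) (hL2 : subspace_lattice L2).

Let S := ordinal_sum L1 L2.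

Let inl_linear : linear (fun x : X1 => (x, 0 : X2)).
Proof. by move=> a u v; congr (_, _); rewrite /= scaler0 addr0. Qed.

Let inr_linear : linear (fun y : X2 => (0 : X1, y)).
Proof. by move=> a u v; congr (_, _); rewrite /= scaler0 addr0. Qed.

Let inl_continuous : continuous (fun x : X1 => (x, 0 : X2)).
Proof. by move=> x; apply: cvg_pair; [exact: cvg_id | exact: cvg_cst]. Qed.

Let inr_continuous : continuous (fun y : X2 => (0 : X1, y)).
Proof. by move=> x; apply: cvg_pair; [exact: cvg_cst | exact: cvg_id]. Qed.

Let pair_decomp (x : X1) (y : X2) : (x, y) = 1 *: (x, 0) + (0, y).
Proof. by congr (_, _); rewrite /= ?scale1r ?scaler0 ?addr0 ?add0r. Qed.

Lemma ordinal_sum_closed : S `<=` closed_subspace.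
Proof.
have [c1 z1 t1 _ _] := hL1; have [c2 z2 t2 _ _] := hL2.
move=> _ [[M LM <-]|[M LM <-]]; apply: closed_subspaceX; auto.
Qed.

Let S_left M : L1 M -> S (M `*` [set 0]).
Proof. by move=> LM; left; exists M. Qed.

Let S_right M : L2 M -> S (setT `*` M).
Proof. by move=> LM; right; exists M. Qed.

(** A member [setT * M] of [F] absorbs all members of the form [M1 * 0], so only the members of its
    kind matter; if there is none, [F] lies in the copy of [L1]. The empty family falls under the
    second case. *)
Lemma ordinal_sum_join F : F `<=` S -> S (subspace_join F).
Proof.
have [c1 z1 t1 j1 _] := hL1; have [c2 z2 t2 j2 _] := hL2.
move=> FS; have cJ := closed_subspace_join F.
have /closed_subspaceP[_ JL _] := cJ.
have [[M0 LM0 FM0]|noR] := pselect (exists2 M, L2 M & F (setT `*` M)).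
- pose G := [set M | L2 M /\ F (setT `*` M)].
  have LG : L2 (subspace_join G) by apply: j2 => M [].
  rewrite (_ : subspace_join F = setT `*` subspace_join G); first exact: S_right.
  apply/seteqP; split.
    apply: subspace_join_min; first exact/ordinal_sum_closed/S_right.
    move=> N FN; have [[M LM E]|[M LM E]] := FS _ FN; rewrite -E.
      by move=> [x y] [_ /= ->]; split=> //; exact: closed_subspace_mem0 (c2 _ LG).
    move=> [x y] [_ /= My]; split=> //=.
    by apply: (sub_subspace_join G M) => //; split=> //; rewrite E.
  move=> [x y] [_ /= Jy].
  rewrite pair_decomp; apply: JL.
    apply: (sub_subspace_join _ _ FM0); split=> //=.
    exact: closed_subspace_mem0 (c2 _ LM0).
  (* The preimage of the join under [y |-> (0, y)] is a closed subspace containing every member of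
     [G], hence their join. *)
  move: y Jy; apply: (subspace_join_min G ((fun y => (0, y)) @^-1` subspace_join F)).
    exact: closed_subspace_preimage.
  by move=> N [LN FN] y Ny; apply: (sub_subspace_join _ _ FN).
- pose G := [set M | L1 M /\ F (M `*` [set 0])].
  have LG : L1 (subspace_join G) by apply: j1 => M [].
  rewrite (_ : subspace_join F = subspace_join G `*` [set 0]); first exact: S_left.
  apply/seteqP; split.
    apply: subspace_join_min; first exact/ordinal_sum_closed/S_left.
    move=> N FN; have [[M LM E]|[M LM E]] := FS _ FN; last first.
      by exfalso; apply: noR; exists M => //; rewrite E.
    rewrite -E => -[x y] [/= Mx y0]; split=> //=.
    by apply: (sub_subspace_join G M) => //; split=> //; rewrite E.
  move=> [x y] [/= Jx ->].
  move: x Jx; apply: (subspace_join_min G ((fun x => (x, 0)) @^-1` subspace_join F)).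
    exact: closed_subspace_preimage.
  by move=> N [LN FN] x Nx; apply: (sub_subspace_join _ _ FN).
Qed.

(** Dual to the join: one member [M * 0] makes the members [setT * M2] irrelevant. The empty family
    again falls under the second case. *)
Lemma ordinal_sum_meet F : F `<=` S -> S (subspace_meet F).
Proof.
have [c1 z1 t1 _ m1] := hL1; have [c2 z2 t2 _ m2] := hL2.
move=> FS.
have [[M0 LM0 FM0]|noL] := pselect (exists2 M, L1 M & F (M `*` [set 0])).
- pose G := [set M | L1 M /\ F (M `*` [set 0])].
  have LG : L1 (subspace_meet G) by apply: m1 => M [].
  rewrite (_ : subspace_meet F = subspace_meet G `*` [set 0]); first exact: S_left.
  apply/seteqP; split.
    move=> [x y] Fxy; split; last by have [] := Fxy _ FM0.
    by move=> M [LM FM]; have [] := Fxy _ FM.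
  move=> [x y] [/= Gx ->] N FN; have [[M LM E]|[M LM E]] := FS _ FN; rewrite -E.
    by split=> //=; apply: Gx; split=> //; rewrite E.
  by split=> //=; exact: closed_subspace_mem0 (c2 _ LM).
- pose G := [set M | L2 M /\ F (setT `*` M)].
  have LG : L2 (subspace_meet G) by apply: m2 => M [].
  rewrite (_ : subspace_meet F = setT `*` subspace_meet G); first exact: S_right.
  apply/seteqP; split.
    move=> [x y] Fxy; split=> // M [LM FM].
    by have [] := Fxy _ FM.
  move=> [x y] [_ /= Gy] N FN; have [[M LM E]|[M LM E]] := FS _ FN.
    by exfalso; apply: noL; exists M => //; rewrite E.
  by rewrite -E; split=> //=; apply: Gy; split=> //; rewrite E.
Qed.

Lemma ordinal_sum_lattice : subspace_lattice S.
Proof.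
have [c1 z1 t1 _ _] := hL1; have [c2 z2 t2 _ _] := hL2.
split.
- exact: ordinal_sum_closed.
- rewrite (_ : [set 0] = [set 0] `*` [set 0]); first exact: S_left.
  by apply/seteqP; split=> [_ ->|[x y] [/= -> ->]].
- by rewrite -setXTT; exact: S_right.
- exact: ordinal_sum_join.
- exact: ordinal_sum_meet.
Qed.

Lemma reflexive_ordinal_suml : reflexive_lattice S -> reflexive_lattice L1.
Proof.
have [c1 z1 t1 _ _] := hL1; have [c2 z2 t2 _ _] := hL2.
move=> /(reflexive_latticeP _ ordinal_sum_closed) rS.
apply/(reflexive_latticeP _ c1) => M /Lat_AlgP[cM HM].
have : S (M `*` [set 0]).
  apply/rS/Lat_AlgP; split; first by apply: closed_subspaceX => //; exact: c2.
  (* [T] preserves X1 (+) 0, so [T (x, 0)] has second component 0; its first component is the corner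
     of [T] in Alg L1. *)
  move=> T lT cT ST [x _] [/= Mx ->]; split=> /=; last first.
    by have [] := ST _ (S_left _ t1) (x, 0) (conj I erefl).
  apply: (HM (fun x => (T (x, 0)).1)) => //.
  - by move=> a u v; rewrite inl_linear lT.
  - apply: (continuousT_comp (fun x => T (x, 0)) fst) => [|u]; last exact: cvg_fst.
    exact: (continuousT_comp _ _ inl_continuous cT).
  - by move=> N LN u Nu; have [] := ST _ (S_left _ LN) (u, 0) (conj Nu erefl).
(* If [M * 0] is of the form [setT * N], then [M] is all of X1, which lies in [L1]. *)
move=> [[N LN /(setX_injl 0)<-]//|[N LN /(setX_injl 0)<-]//].
exact: closed_subspace_mem0 (c2 _ LN).
Qed.

Lemma reflexive_ordinal_sumr : reflexive_lattice S -> reflexive_lattice L2.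
Proof.
have [c1 z1 t1 _ _] := hL1; have [c2 z2 t2 _ _] := hL2.
move=> /(reflexive_latticeP _ ordinal_sum_closed) rS.
apply/(reflexive_latticeP _ c2) => M /Lat_AlgP[cM HM].
have M0 := closed_subspace_mem0 cM.
have : S (setT `*` M).
  apply/rS/Lat_AlgP; split; first by apply: closed_subspaceX => //; exact: c1.
  move=> T lT cT ST [x y] [_ /= My]; split=> //=.
  rewrite pair_decomp lT /=.
  (* Invariance of X1 (+) 0 makes the second component of [T (x, y)] depend on [y] alone. *)
  have [_ /= ->] := ST _ (S_left _ t1) (x, 0) (conj I erefl).
  rewrite scaler0 add0r.
  apply: (HM (fun y => (T (0, y)).2)) => //.
  - by move=> a u v; rewrite inr_linear lT.
  - apply: (continuousT_comp (fun y => T (0, y)) snd) => [|u]; last exact: cvg_snd.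
    exact: (continuousT_comp _ _ inr_continuous cT).
  - by move=> N LN u Nu; have [] := ST _ (S_right _ LN) (0, u) (conj I Nu).
(* If [setT * M] is of the form [N * 0], then [M] is zero, which lies in [L2]. *)
move=> [[N LN /(setX_injr 0)<-]//|[N LN /(setX_injr 0)<-]//].
exact: closed_subspace_mem0 (c1 _ LN).
Qed.

(** The one consequence of Hahn-Banach used below, isolated so that the argument runs over any
    [numFieldType]. *)
Hypothesis functionals : forall y : X2, y != 0 ->
  exists f : {linear X2 -> K^o}, continuous f /\ f y = 1.

Lemma reflexive_ordinal_sum :
  reflexive_lattice L1 -> reflexive_lattice L2 -> reflexive_lattice S.
Proof.
have [c1 z1 t1 _ _] := hL1; have [c2 z2 t2 _ _] := hL2.
move=> /(reflexive_latticeP _ c1) r1 /(reflexive_latticeP _ c2) r2.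
apply/(reflexive_latticeP _ ordinal_sum_closed) => N /Lat_AlgP[cN HN].
have /closed_subspaceP[_ NL _] := cN.
have [NX1|] := pselect (forall p, N p -> p.2 = 0).
- pose M := (fun x => (x, 0)) @^-1` N.
  rewrite (_ : N = M `*` [set 0]); last first.
    apply/seteqP; split=> [[x y] Nxy|[x y] [/= Mx ->]//].
    by have /= y0 := NX1 _ Nxy; rewrite y0 in Nxy *.
  apply/S_left/r1/Lat_AlgP; split; first exact: closed_subspace_preimage.
  move=> A lA cA L1A x Mx.
  (* The block matrix with A in the upper left corner and zeros elsewhere belongs to Alg S. *)
  apply: (HN (fun p => (A p.1, 0))) Mx.
  - by move=> a u v; rewrite /= lA inl_linear.
  - have cfst : continuous (@fst X1 X2) by move=> u; exact: cvg_fst.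
    exact: (continuousT_comp _ _ (continuousT_comp _ _ cfst cA) inl_continuous).
  - move=> _ [[M' LM' <-]|[M' LM' <-]] [u v] [/= Mu Mv]; split=> //=.
      exact: (L1A _ LM').
    exact: closed_subspace_mem0 (c2 _ LM').
- move=> /existsNP[[x0 y0] /not_implyP[Nxy /= /eqP /functionals [f [cf fy]]]].
  have NX1 x : N (x, 0).
    have -> : (x, 0) = (fun p : X1 * X2 => (f p.2 *: x, 0 : X2)) (x0, y0).
      by rewrite /= fy scale1r.
    (* This operator kills X1 (+) 0 and maps everything into X1 (+) 0, so it leaves both kinds of
       members of [S] invariant. *)
    apply: (HN (fun p => (f p.2 *: x, 0 : X2))) Nxy.
    - by move=> a u v; rewrite /= linearP scalerDl -scalerA inl_linear.
    - have csnd : continuous (@snd X1 X2) by move=> u; exact: cvg_snd.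
      have cfx : continuous (fun p : X1 * X2 => f p.2 *: x).
        by move=> u; apply: cvgZl; exact: (continuousT_comp _ _ csnd cf).
      exact: (continuousT_comp _ _ cfx inl_continuous).
    - move=> _ [[M' LM' <-]|[M' LM' <-]] [u v] [/= Mu Mv]; split=> //=.
        rewrite Mv linear0 scale0r.
        exact: closed_subspace_mem0 (c1 _ LM').
      exact: closed_subspace_mem0 (c2 _ LM').
  pose M := (fun y => (0, y)) @^-1` N.
  rewrite (_ : N = setT `*` M); last first.
    apply/seteqP; split=> [[x y] Nxy'|[x y] [_ /= My]].
      split=> //; rewrite /M /preimage /=.
      (* Subtracting [(x, 0)], now known to lie in [N], leaves [(0, y)]. *)
      have := NL (-1) _ _ (NX1 x) Nxy'.
      by congr N; congr (_, _); rewrite /= ?scaleN1r ?addNr ?oppr0 ?add0r.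
    by rewrite pair_decomp; exact: NL.
  apply/S_right/r2/Lat_AlgP; split; first exact: closed_subspace_preimage.
  move=> A lA cA L2A y My.
  apply: (HN (fun p => (0, A p.2))) My.
  - by move=> a u v; rewrite /= lA inr_linear.
  - have csnd : continuous (@snd X1 X2) by move=> u; exact: cvg_snd.
    exact: (continuousT_comp _ _ (continuousT_comp _ _ csnd cA) inr_continuous).
  - move=> _ [[M' LM' <-]|[M' LM' <-]] [u v] [/= Mu Mv]; split=> //=.
    + exact: closed_subspace_mem0 (c1 _ LM').
    + by rewrite Mv; have := lA (-1) 0 0; rewrite scaler0 addr0 scaleN1r addNr.
    + exact: (L2A _ LM').
Qed.

End OrdinalSum.

Theorem theorem2 (R : realType) (X1 X2 : completeNormedModType R[i])
    (L1 : set (set X1)) (L2 : set (set X2))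
    (hL1 : subspace_lattice L1) (hL2 : subspace_lattice L2) :
  subspace_lattice (ordinal_sum L1 L2) /\
  (reflexive_lattice (ordinal_sum L1 L2) <->
   reflexive_lattice L1 /\ reflexive_lattice L2).
Proof.
split; first exact: ordinal_sum_lattice.
split=> [rS|[r1 r2]].
  by split; [exact: reflexive_ordinal_suml rS | exact: reflexive_ordinal_sumr rS].
by apply: reflexive_ordinal_sum => // y; exact: continuous_functional_eq1.
Qed.
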